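(* Consider the following list of matrices in $M_2(\mathcal D)$: (i) $\operatorname{diag}(\alpha_1+\beta_1\zeta,\ \alpha_2+\beta_2\zeta)$ with $\alpha_1,\alpha_2,\beta_1,\beta_2\in K$, $\alpha_1\ne\alpha_2$; (ii) $J_{2,\alpha}+\begin{pmatrix}\beta_3&0\\ \beta_4&0\end{pmatrix}\zeta$ with $\alpha,\beta_3,\beta_4\in K$; (iii) $\alpha E_2+J\zeta$ with $\alpha\in K$, where $J$ is either $\operatorname{diag}(\gamma_1,\gamma_2)$ with $\gamma_1,\gamma_2\in K$, or $J_{2,\gamma_3}$ with $\gamma_3\in K$. Then every matrix in $M_2(\mathcal D)$ is similar to a matrix in this list, and two matrices in the list are similar if and only if they are equal or they are both diagonal matrices (of type (i), or of type (iii) with $J$ diagonal) that differ by a permutation of the diagonal elements.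
   Context: $K$ is an algebraically closed field of characteristic zero and $\mathcal D=K[\zeta]$ with $\zeta^2=0$ is the algebra of dual numbers over $K$. Matrices $X,Y\in M_n(\mathcal D)$ are similar if $Y=CXC^{-1}$ for some invertible $C\in M_n(\mathcal D)$. $E_n$ is the identity matrix, and $J_{n,\alpha}$ is the upper triangular Jordan block of order $n$ with eigenvalue $\alpha$ (ones on the superdiagonal). *)

(* Defs.v *)
From HB Require Import structures.
From mathcomp Require Import all_boot all_order all_fingroup all_algebra.

Set Implicit Arguments.
Unset Strict Implicit.
Unset Printing Implicit Defensive.

Import GRing.Theory.
Local Open Scope ring_scope.

(* K[zeta] with zeta^2 = 0, as the quotient K[X]/(X^2). *)
Definition dual (K : fieldType) := {poly %/ ('X^2 : {poly K})}.

HB.instance Definition _ (K : fieldType) := GRing.ComUnitAlgebra.on (dual K).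

Definition zeta (K : fieldType) : dual K := 'qX.

Lemma zeta_sqr (K : fieldType) : zeta K ^+ 2 = 0.
Proof.
rewrite /zeta /qpolyX -rmorphXn /=; apply: val_inj.
by rewrite /= mk_monic_Xn (Pdiv.RingMonic.rmodpp (monicXn K 2)).
Qed.

(* [1; zeta] is a K-basis of the dual numbers. *)
Lemma dual_basis (K : fieldType) (x : dual K) :
  exists! ab : K * K, x = ab.1%:A + ab.2 *: zeta K.
Proof.
have valE (a b : K) : val (a%:A + b *: zeta K : dual K) = a%:P + b *: 'X.
  have eX : polyn (zeta K) = 'X :> {poly K}
    by rewrite [LHS]qpolyXE ?size_polyXn ?monicXn.
  by rewrite -[in RHS]eX -alg_polyC.
exists ((val x)`_0, (val x)`_1); split.
  apply: val_inj; rewrite valE; apply/polyP => i.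
  rewrite coefD coefC coefZ coefX /=.
  case: i => [|[|i]] /=; rewrite ?mulr0 ?mulr1 ?addr0 ?add0r //.
  rewrite nth_default // -ltnS; apply: leq_trans (size_mk_monic x) _.
  by rewrite mk_monic_Xn size_polyXn.
case=> a b /= ->; rewrite valE !coefD !coefC !coefZ !coefX /=.
by rewrite mulr0 mulr1 addr0 add0r.
Qed.

Definition similar_mx (R : comUnitRingType) (n : nat) (X Y : 'M[R]_n) : Prop :=
  exists C : 'M[R]_n, C \in unitmx /\ Y = C *m X *m invmx C.

(* Extension of scalars from K to the dual numbers. *)
Definition dualmx (K : fieldType) (n : nat) (A : 'M[K]_n) : 'M[dual K]_n :=
  map_mx (in_alg (dual K)) A.

Definition jordan_block (R : nzRingType) (n : nat) (a : R) : 'M[R]_n :=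
  \matrix_(i, j) (a *+ (i == j) + (i.+1 == j :> nat)%:R).

Definition diag2 (R : nzRingType) (a b : R) : 'M[R]_2 :=
  diag_mx (\row_(i < 2) [:: a; b]`_i).

Definition type_i (K : fieldType) (X : 'M[dual K]_2) : Prop :=
  exists a1 a2 b1 b2 : K,
    a1 != a2 /\ X = diag2 (a1%:A + b1 *: zeta K) (a2%:A + b2 *: zeta K).

(* The matrix multiplied by zeta has first column (b3, b4) and zero second
   column. *)
Definition type_ii (K : fieldType) (X : 'M[dual K]_2) : Prop :=
  exists a b3 b4 : K,
    X = dualmx (jordan_block 2 a) +
        zeta K *: dualmx (\matrix_(i < 2, j < 2)
                            (if j == 0 then [:: b3; b4]`_i else 0)).

Definition type_iii_diag (K : fieldType) (X : 'M[dual K]_2) : Prop :=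
  exists a g1 g2 : K,
    X = dualmx a%:M + zeta K *: dualmx (diag2 g1 g2).

Definition type_iii_jordan (K : fieldType) (X : 'M[dual K]_2) : Prop :=
  exists a g3 : K,
    X = dualmx a%:M + zeta K *: dualmx (jordan_block 2 g3).

Definition in_list (K : fieldType) (X : 'M[dual K]_2) : Prop :=
  [\/ type_i X, type_ii X, type_iii_diag X | type_iii_jordan X].

Definition in_list_diag (K : fieldType) (X : 'M[dual K]_2) : Prop :=
  type_i X \/ type_iii_diag X.

Definition diag_perm (R : nzRingType) (n : nat) (X Y : 'M[R]_n) : Prop :=
  exists (d : 'rV[R]_n) (s : 'S_n), X = diag_mx d /\ Y = diag_mx (col_perm s d).

(* Main.v *)
Require Import Defs.
From HB Require Import structures.
From mathcomp Require Import all_boot all_order all_fingroup all_algebra ring.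

(* A matrix whose residue modulo zeta is not scalar has a vector v such that
   (v, vX) is a basis, because the dual numbers form a local ring; it is then
   similar to the companion matrix of its characteristic polynomial, so its
   class is determined by its trace and determinant, and these can be prescribed
   within types (i) and (ii).  If the residue is scalar, X = a + zeta B, and
   similarity reduces to similarity of B over K, where the same dichotomy gives
   the two cases of type (iii). *)

Set Implicit Arguments.
Unset Strict Implicit.
Unset Printing Implicit Defensive.

Import GRing.Theory.
Local Open Scope ring_scope.

(** * Similarity over a commutative ring *)

Section Similarity.
Variables (R : comUnitRingType) (n : nat).
Implicit Types (X Y Z P : 'M[R]_n).

Lemma similar_mxP X Y :
  similar_mx X Y <-> exists2 P, P \in unitmx & P *m X = Y *m P.
Proof.
split=> [[C [uC ->]]|[P uP PX]]; first by exists C => //; rewrite mulmxKV.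
by exists P; split=> //; rewrite PX mulmxK.
Qed.

Lemma similar_mx_refl X : similar_mx X X.
Proof. by exists 1%:M; rewrite unitmx1 mul1mx invmx1 mulmx1. Qed.

Lemma similar_mx_sym X Y : similar_mx X Y -> similar_mx Y X.
Proof.
case=> C [uC ->]; exists (invmx C); rewrite unitmx_inv invmxK; split=> //.
by rewrite -!mulmxA mulVmx // mulmx1 mulKmx.
Qed.

Lemma similar_mx_trans X Y Z :
  similar_mx X Y -> similar_mx Y Z -> similar_mx X Z.
Proof.
move=> /similar_mxP[P uP PX] /similar_mxP[Q uQ QY].
apply/similar_mxP; exists (Q *m P); first by rewrite unitmx_mul uQ.
by rewrite -mulmxA PX mulmxA QY mulmxA.
Qed.

Lemma similar_mxtrace X Y : similar_mx X Y -> \tr X = \tr Y.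
Proof. by case=> C [uC ->]; rewrite mxtrace_mulC mulmxA mulVmx // mul1mx. Qed.

Lemma similar_det X Y : similar_mx X Y -> \det X = \det Y.
Proof.
case=> C [uC ->]; rewrite !det_mulmx det_inv mulrAC mulrV ?mul1r //.
Qed.

Lemma similar_scalar_mx a Y : similar_mx a%:M Y -> Y = a%:M.
Proof. by case=> C [uC ->]; rewrite scalar_mxC mulmxK. Qed.

(** Conjugation by the permutation matrix of [s] permutes the diagonal entries. *)
Lemma similar_diag_perm X Y : diag_perm X Y -> similar_mx X Y.
Proof.
case=> d [s [-> ->]]; apply/similar_mxP; exists (perm_mx s).
  exact: unitmx_perm.
apply/matrixP=> i j; rewrite mul_mx_diag mul_diag_mx !mxE.
by case: eqP => [<-|]; rewrite ?mulr0 ?mul0r // mulrC.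
Qed.

End Similarity.

Lemma map_similar_mx (R S : comUnitRingType) (f : {rmorphism R -> S}) n
    (X Y : 'M[R]_n) :
  similar_mx X Y -> similar_mx (map_mx f X) (map_mx f Y).
Proof.
move=> /similar_mxP[P uP PX]; apply/similar_mxP; exists (map_mx f P).
  by rewrite unitmxE det_map_mx rmorph_unit -?unitmxE.
by rewrite -!map_mxM PX.
Qed.

(** * Matrices of order two in explicit coordinates *)

Definition mx2 (R : nzRingType) (a b c d : R) : 'M[R]_2 :=
  \matrix_(i, j) if i == 0 then (if j == 0 then a else b)
                 else (if j == 0 then c else d).

Lemma mx2E (R : nzRingType) (X : 'M[R]_2) :
  X = mx2 (X 0 0) (X 0 1) (X 1 0) (X 1 1).
Proof.
apply/matrixP=> i j; rewrite !mxE.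
by case: i => [[|[|//]] hi]; case: j => [[|[|//]] hj];
  congr (X _ _); apply: val_inj.
Qed.

Lemma mx2_inj (R : nzRingType) (a b c d a' b' c' d' : R) :
  mx2 a b c d = mx2 a' b' c' d' -> [/\ a = a', b = b', c = c' & d = d'].
Proof.
move=> /matrixP e.
by move: (e 0 0) (e 0 1) (e 1 0) (e 1 1); rewrite !mxE.
Qed.

Lemma mul_mx2 (R : nzRingType) (a b c d a' b' c' d' : R) :
  mx2 a b c d *m mx2 a' b' c' d' =
  mx2 (a * a' + b * c') (a * b' + b * d') (c * a' + d * c') (c * b' + d * d').
Proof.
by rewrite [LHS]mx2E; congr mx2; rewrite mxE !big_ord_recl big_ord0 addr0 !mxE.
Qed.

Lemma det_mx2 (R : comNzRingType) (a b c d : R) :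
  \det (mx2 a b c d) = a * d - b * c.
Proof.
rewrite (expand_det_row _ 0) !big_ord_recl big_ord0 addr0 /cofactor.
by rewrite !det_mx11 !mxE /=; ring.
Qed.

Lemma mxtrace_mx2 (R : nzRingType) (a b c d : R) : \tr (mx2 a b c d) = a + d.
Proof. by rewrite /mxtrace !big_ord_recl big_ord0 addr0 !mxE. Qed.

Lemma map_mx2 (R S : nzRingType) (f : R -> S) (a b c d : R) :
  map_mx f (mx2 a b c d) = mx2 (f a) (f b) (f c) (f d).
Proof. by rewrite [LHS]mx2E !mxE. Qed.

Lemma scalar_mx2 (R : nzRingType) (a : R) : a%:M = mx2 a 0 0 a.
Proof. by rewrite [LHS]mx2E !mxE. Qed.

Lemma diag2E (R : nzRingType) (a b : R) : diag2 a b = mx2 a 0 0 b.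
Proof. by rewrite [LHS]mx2E !mxE. Qed.

Lemma jordan_block2E (R : nzRingType) (a : R) :
  jordan_block 2 a = mx2 a 1 0 a.
Proof. by rewrite [LHS]mx2E !mxE /= !addr0 add0r. Qed.

Lemma diag_perm_swap (R : nzRingType) (a b : R) :
  diag_perm (diag2 a b) (diag2 b a).
Proof.
exists (\row_(i < 2) [:: a; b]`_i), (tperm 0 1); split=> //.
congr diag_mx; apply/rowP=> i; rewrite !mxE.
have [->|->]: i = 0 \/ i = 1.
- by case: i => [[|[|//]] hi]; [left|right]; apply: val_inj.
- by rewrite tpermL.
- by rewrite tpermR.
Qed.

(** * Cyclic matrices of order two *)

(* For v = (x, y), the matrix below has rows v and v X. *)
Definition cyclic_mx (R : comUnitRingType) (X : 'M[R]_2) : Prop :=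
  exists x y : R,
    mx2 x y (x * X 0 0 + y * X 1 0) (x * X 0 1 + y * X 1 1) \in unitmx.

(* By Cayley-Hamilton, in the basis (v, v X) the matrix X becomes the
   companion matrix of its characteristic polynomial. *)
Lemma cyclic_companion (R : comUnitRingType) (X : 'M[R]_2) :
  cyclic_mx X -> similar_mx X (mx2 0 1 (- \det X) (\tr X)).
Proof.
rewrite [X]mx2E; move: (X 0 0) (X 0 1) (X 1 0) (X 1 1) => a b c d.
case=> x [y]; rewrite !mxE /= => uP; apply/similar_mxP.
exists (mx2 x y (x * a + y * c) (x * b + y * d)) => //.
by rewrite det_mx2 mxtrace_mx2 !mul_mx2; congr mx2; ring.
Qed.

(** Both matrices are similar to the same companion matrix. *)
Lemma cyclic_similar (R : comUnitRingType) (X Y : 'M[R]_2) :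
  cyclic_mx X -> cyclic_mx Y -> \tr X = \tr Y -> \det X = \det Y ->
  similar_mx X Y.
Proof.
move=> /cyclic_companion cX /cyclic_companion cY tXY dXY.
apply: similar_mx_trans cX _; rewrite tXY dXY; exact: similar_mx_sym.
Qed.

(** Three test vectors suffice: (1, 0) gives determinant b, (0, 1) gives -c, and (1, 1) gives d - a
    once b = c = 0. If all three vanish, the matrix is scalar. *)
Lemma cyclic_or_scalar (K : fieldType) (X : 'M[K]_2) :
  cyclic_mx X \/ exists a, X = a%:M.
Proof.
rewrite [X]mx2E; move: (X 0 0) (X 0 1) (X 1 0) (X 1 1) => a b c d.
have unitE x y : (mx2 x y (x * a + y * c) (x * b + y * d) \in unitmx) =
    (x * (x * b + y * d) - y * (x * a + y * c) != 0).
  by rewrite unitmxE det_mx2 unitfE.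
have [b0|b0] := eqVneq b 0; last first.
  left; exists 1, 0; rewrite !mxE /= unitE.
  by rewrite !mul1r !mul0r addr0 subr0.
have [c0|c0] := eqVneq c 0; last first.
  left; exists 0, 1; rewrite !mxE /= unitE.
  by rewrite !mul1r !mul0r !add0r oppr_eq0.
have [ad|ad] := eqVneq d a.
  by right; exists a; rewrite scalar_mx2 b0 c0 ad.
left; exists 1, 1; rewrite !mxE /= unitE.
by rewrite b0 c0 !mul1r add0r addr0 subr_eq0.
Qed.

(** Here v X is a multiple of v, so the determinant is 0 for every v. *)
Lemma not_cyclic_scalar (R : comUnitRingType) (a : R) :
  ~ cyclic_mx (a%:M : 'M_2).
Proof.
case=> x [y]; rewrite scalar_mx2 !mxE /= unitmxE det_mx2.
by rewrite (_ : _ - _ = 0) ?unitr0 //; ring.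
Qed.

Lemma cyclic_nonscalar (K : fieldType) (a b c d : K) :
  [|| b != 0, c != 0 | a != d] -> cyclic_mx (mx2 a b c d).
Proof.
have [//|[e]] := cyclic_or_scalar (mx2 a b c d).
rewrite scalar_mx2 => /mx2_inj[-> -> -> ->].
by rewrite !eqxx.
Qed.

(** * Eigenvalues and the Jordan form over the base field *)

Lemma vieta2 (K : closedFieldType) (t d : K) :
  exists a b, a + b = t /\ a * b = d.
Proof.
(* The list [[:: - d; t]] encodes x^2 = t x - d, so x is a root of X^2 - t X + d and the other root
   is t - x. *)
have [x] := @solve_monicpoly K 2 (fun i => [:: - d; t]`_i) isT.
rewrite !big_ord_recl big_ord0 /= => ex.
exists x, (t - x); split; first by ring.
have -> : x * (t - x) = t * x - x ^+ 2 by ring.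
by rewrite ex; ring.
Qed.

(** The element a is a root of X^2 - (c + d) X + c d = (X - c)(X - d), and a domain has no zero
    divisors. *)
Lemma vieta2_uniq (R : idomainType) (a b c d : R) :
  a + b = c + d -> a * b = c * d -> (a = c /\ b = d) \/ (a = d /\ b = c).
Proof.
move=> s p; have : (a - c) * (a - d) = 0.
  have -> : (a - c) * (a - d) = a ^+ 2 - (c + d) * a + c * d by ring.
  by rewrite -s -p; ring.
move/eqP; rewrite mulf_eq0 !subr_eq0 => /orP[]/eqP e; [left|right];
  split=> //; apply: (addrI a); rewrite s e //; exact: addrC.
Qed.

(** A cyclic matrix is determined up to similarity by trace and determinant. It is matched with a
    cyclic representative having the same eigenvalues: a Jordan block if they coincide, a diagonal
    matrix if not. *)
Lemma jordan_form2 (K : closedFieldType) (B : 'M[K]_2) :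
  exists2 J, similar_mx B J &
    (exists g1 g2, J = diag2 g1 g2) \/ (exists g, J = jordan_block 2 g).
Proof.
have [cB|[a ->]] := cyclic_or_scalar B; last first.
  exists a%:M; first exact: similar_mx_refl.
  by left; exists a, a; rewrite scalar_mx2 diag2E.
have [g1 [g2 [tB dB]]] := vieta2 (\tr B) (\det B).
have [e|ne] := eqVneq g1 g2.
  exists (jordan_block 2 g1); last by right; exists g1.
  rewrite jordan_block2E; apply: cyclic_similar => //.
  - by apply: cyclic_nonscalar; rewrite oner_neq0.
  - by rewrite mxtrace_mx2 -tB e.
  - by rewrite det_mx2 -dB e mulr0 subr0.
exists (diag2 g1 g2); last by left; exists g1, g2.
rewrite diag2E; apply: cyclic_similar => //.
- by apply: cyclic_nonscalar; rewrite ne !orbT.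
- by rewrite mxtrace_mx2 -tB.
- by rewrite det_mx2 -dB mulr0 subr0.
Qed.

(** * Coordinates on the dual numbers and reduction modulo zeta *)

Section DualNumbers.
Variable K : fieldType.

Definition mkdual (a b : K) : dual K := a%:A + b *: zeta K.

(** The boolean [==] lets [xchoose] extract the two coordinates as functions. *)
Lemma mkdual_surj (x : dual K) : exists ab, x == mkdual ab.1 ab.2.
Proof. by have [ab [-> _]] := dual_basis x; exists ab. Qed.

Definition dual_re (x : dual K) : K := (xchoose (mkdual_surj x)).1.
Definition dual_eps (x : dual K) : K := (xchoose (mkdual_surj x)).2.

Lemma dualE x : x = mkdual (dual_re x) (dual_eps x).
Proof. exact/eqP/(xchooseP (mkdual_surj x)). Qed.

Lemma mkdual_inj a b c d : mkdual a b = mkdual c d -> a = c /\ b = d.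
Proof.
move=> e; have [ab [_ u]] := dual_basis (mkdual a b).
by case: (etrans (esym (u (a, b) erefl)) (u (c, d) e)).
Qed.

Lemma mkdualK a b : dual_re (mkdual a b) = a.
Proof. by have [] := mkdual_inj (esym (dualE (mkdual a b))). Qed.

Lemma mkdualD a b c d : mkdual a b + mkdual c d = mkdual (a + c) (b + d).
Proof. by rewrite /mkdual !scalerDl addrACA. Qed.

Lemma mkdualN a b : - mkdual a b = mkdual (- a) (- b).
Proof. by rewrite /mkdual !scaleNr opprD. Qed.

Lemma mkdualM a b c d :
  mkdual a b * mkdual c d = mkdual (a * c) (a * d + b * c).
Proof.
rewrite /mkdual mulrDl !mulrDr -!(scalerAl, scalerAr) !(mul1r, mulr1).
by rewrite -expr2 zeta_sqr !scaler0 addr0 !scalerA scalerDl addrA.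
Qed.

Lemma mkdual_alg a : a%:A = mkdual a 0.
Proof. by rewrite /mkdual scale0r addr0. Qed.

Lemma dual_re_alg a : dual_re a%:A = a.
Proof. by rewrite mkdual_alg mkdualK. Qed.

Fact dual_re_is_zmod_morphism : zmod_morphism dual_re.
Proof.
by move=> x y; rewrite {1}[x]dualE {1}[y]dualE mkdualN mkdualD mkdualK.
Qed.

Fact dual_re_is_monoid_morphism : monoid_morphism dual_re.
Proof.
split; first by rewrite -[1]scale1r mkdual_alg mkdualK.
by move=> x y; rewrite {1}[x]dualE {1}[y]dualE mkdualM mkdualK.
Qed.

HB.instance Definition _ :=
  GRing.isZmodMorphism.Build (dual K) K dual_re dual_re_is_zmod_morphism.
HB.instance Definition _ :=
  GRing.isMonoidMorphism.Build (dual K) K dual_re dual_re_is_monoid_morphism.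

Lemma dual_unit x : dual_re x != 0 -> x \is a GRing.unit.
Proof.
(* Since zeta^2 = 0, the inverse of a + b zeta is a^-1 - b a^-2 zeta. *)
move=> x0; apply/unitrP; exists (mkdual (dual_re x)^-1
  (- dual_eps x * (dual_re x)^-1 ^+ 2)).
rewrite mulrC; suff -> : x * mkdual (dual_re x)^-1
  (- dual_eps x * (dual_re x)^-1 ^+ 2) = 1 by [].
rewrite {1}[x]dualE mkdualM -[1]scale1r mkdual_alg; congr mkdual.
  exact: divff.
by field.
Qed.

(** The vector found over K is lifted by constants; the determinant of the lifted basis has nonzero
    residue, hence is a unit. *)
Lemma cyclic_lift (X : 'M[dual K]_2) :
  cyclic_mx (map_mx dual_re X) -> cyclic_mx X.
Proof.
case=> x [y]; rewrite !mxE unitmxE unitfE => u.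
exists x%:A, y%:A; rewrite unitmxE; apply: dual_unit.
rewrite -det_map_mx map_mx2 !rmorphD !rmorphM.
by rewrite /= !dual_re_alg.
Qed.

(** As zeta (a + b zeta) = a zeta, multiplication by zeta remembers exactly the residue. *)
Lemma mul_zeta_inj (x y : dual K) :
  zeta K * x = zeta K * y -> dual_re x = dual_re y.
Proof.
have -> : zeta K = mkdual 0 1 by rewrite /mkdual scale0r add0r scale1r.
rewrite [x]dualE [y]dualE !mkdualM !mkdualK !mul0r !mul1r !add0r.
by move=> /mkdual_inj[].
Qed.

(** * Matrices over the dual numbers, and the list in coordinates *)

Definition mkdualmx n (A B : 'M[K]_n) : 'M[dual K]_n :=
  \matrix_(i, j) mkdual (A i j) (B i j).

Lemma mkdualmxE n (A B : 'M[K]_n) :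
  dualmx A + zeta K *: dualmx B = mkdualmx A B.
Proof.
by apply/matrixP=> i j; rewrite !mxE /mkdual /= -scalerAr mulr1.
Qed.

Lemma mkdualmx_surj n (X : 'M[dual K]_n) :
  X = mkdualmx (map_mx dual_re X) (map_mx dual_eps X).
Proof. by apply/matrixP=> i j; rewrite !mxE -dualE. Qed.

Lemma map_mkdualmx n (A B : 'M[K]_n) : map_mx dual_re (mkdualmx A B) = A.
Proof. by apply/matrixP=> i j; rewrite !mxE mkdualK. Qed.

Lemma map_dualmx n (A : 'M[K]_n) : map_mx dual_re (dualmx A) = A.
Proof. by apply/matrixP=> i j; rewrite !mxE /= dual_re_alg. Qed.

Lemma mkdualmx2 (a b c d a' b' c' d' : K) :
  mkdualmx (mx2 a b c d) (mx2 a' b' c' d') =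
  mx2 (mkdual a a') (mkdual b b') (mkdual c c') (mkdual d d').
Proof. by rewrite [LHS]mx2E !mxE. Qed.

(** The scalar part is central and cancels, leaving zeta P B = zeta B' P; by [mul_zeta_inj] the
    residue of P then conjugates B into B'. Conversely, a conjugating matrix over K is extended to
    the dual numbers. *)
Lemma similar_scalar_zeta n (a : K) (B B' : 'M[K]_n) :
  similar_mx (mkdualmx a%:M B) (mkdualmx a%:M B') <-> similar_mx B B'.
Proof.
split=> /similar_mxP[P uP]; rewrite -?mkdualmxE => PB; apply/similar_mxP.
  exists (map_mx dual_re P).
    by rewrite unitmxE det_map_mx rmorph_unit -?unitmxE.
  move: PB; rewrite /dualmx map_scalar_mx mulmxDr mulmxDl scalar_mxC.
  move=> /addrI; rewrite -scalemxAr -scalemxAl => /matrixP PB.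
  rewrite -{1}[B]map_dualmx -[B']map_dualmx -!map_mxM.
  by apply/matrixP=> i j; rewrite !mxE; apply: mul_zeta_inj;
     have := PB i j; rewrite !mxE.
exists (dualmx P); first by rewrite unitmxE det_map_mx rmorph_unit -?unitmxE.
rewrite mulmxDr mulmxDl -scalemxAr -scalemxAl -!map_mxM PB.
by rewrite scalar_mxC.
Qed.

Lemma type_iiE (X : 'M[dual K]_2) : type_ii X <->
  exists a b3 b4, X = mkdualmx (mx2 a 1 0 a) (mx2 b3 0 b4 0).
Proof.
have eB (b3 b4 : K) :
    \matrix_(i < 2, j < 2) (if j == 0 then [:: b3; b4]`_i else 0) =
    mx2 b3 0 b4 0.
  by rewrite [LHS]mx2E !mxE.
by split=> -[a [b3 [b4 ->]]]; exists a, b3, b4;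
  rewrite ?mkdualmxE jordan_block2E eB // mkdualmxE.
Qed.

Lemma type_iE (X : 'M[dual K]_2) : type_i X <->
  exists a1 a2 b1 b2, a1 != a2 /\ X = mkdualmx (diag2 a1 a2) (diag2 b1 b2).
Proof.
have e (a1 a2 b1 b2 : K) : mkdualmx (diag2 a1 a2) (diag2 b1 b2) =
    diag2 (a1%:A + b1 *: zeta K) (a2%:A + b2 *: zeta K).
  by rewrite !diag2E mkdualmx2 /mkdual !scale0r !addr0.
by split=> -[a1 [a2 [b1 [b2 [ne ->]]]]]; exists a1, a2, b1, b2; rewrite e.
Qed.

Lemma type_iii_diagE (X : 'M[dual K]_2) : type_iii_diag X <->
  exists a g1 g2, X = mkdualmx a%:M (diag2 g1 g2).
Proof.
by split=> -[a [g1 [g2 ->]]]; exists a, g1, g2; rewrite mkdualmxE.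
Qed.

Lemma type_iii_jordanE (X : 'M[dual K]_2) : type_iii_jordan X <->
  exists a g, X = mkdualmx a%:M (jordan_block 2 g).
Proof. by split=> -[a [g ->]]; exists a, g; rewrite mkdualmxE. Qed.

Lemma mkdualmx_diag_swap (a b c d : K) :
  diag_perm (mkdualmx (diag2 a b) (diag2 c d))
    (mkdualmx (diag2 b a) (diag2 d c)).
Proof.
rewrite !diag2E !mkdualmx2 (_ : mkdual 0 0 = 0); last first.
  by rewrite /mkdual !scale0r addr0.
by rewrite -!diag2E; apply: diag_perm_swap.
Qed.

(** * Comparing listed matrices by trace and determinant *)

Lemma mkdualmx2_tr (a b c d a' b' c' d' : K) :
  \tr (mkdualmx (mx2 a b c d) (mx2 a' b' c' d')) = mkdual (a + d) (a' + d').
Proof. by rewrite mkdualmx2 mxtrace_mx2 mkdualD. Qed.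

Lemma mkdualmx2_det (a b c d a' b' c' d' : K) :
  \det (mkdualmx (mx2 a b c d) (mx2 a' b' c' d')) =
  mkdual (a * d - b * c) (a * d' + a' * d - (b * c' + b' * c)).
Proof. by rewrite mkdualmx2 det_mx2 !mkdualM mkdualN mkdualD. Qed.

(** The residues of trace and determinant give the residual eigenvalues up to order; the two orders
    lead to equality and to a swap. *)
Lemma similar_type_i (X Y : 'M[dual K]_2) : type_i X -> type_i Y ->
  similar_mx X Y -> X = Y \/ diag_perm X Y.
Proof.
move=> /type_iE[a1 [a2 [b1 [b2 [ne ->]]]]] /type_iE[c1 [c2 [d1 [d2 [_ ->]]]]] s.
move: (similar_mxtrace s) (similar_det s); rewrite !diag2E.
rewrite !mkdualmx2_tr !mkdualmx2_det !(mul0r, addr0, subr0).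
move=> /mkdual_inj[t0 t1] /mkdual_inj[p0 p1].
(* Once the residues agree, the coefficients of [zeta] solve a linear system
   with determinant [a1 - a2]. *)
have uniq x1 x2 : b1 + b2 = x1 + x2 -> a1 * b2 + b1 * a2 = a1 * x2 + x1 * a2 ->
    b1 = x1 /\ b2 = x2.
  move=> e1 e2; have e : b1 = x1.
    have /mulfI : a2 - a1 != 0 by rewrite subr_eq0 eq_sym.
    apply; have -> : (a2 - a1) * b1 =
      (a1 * b2 + b1 * a2) - a1 * (b1 + b2) by ring.
    by rewrite e1 e2; ring.
  by split=> //; apply: (addrI b1); rewrite {2}e.
case: (vieta2_uniq t0 p0) => -[ac1 ac2]; subst c1 c2.
  by have [-> ->] := uniq _ _ t1 p1; left.
have [|| -> ->] := uniq d2 d1; [by rewrite t1 addrC | by rewrite p1; ring |].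
by right; rewrite -!diag2E; apply: mkdualmx_diag_swap.
Qed.

(** The trace is 2a + b3 zeta and the determinant a^2 + (a b3 - b4) zeta, so a, b3 and b4 can be
    recovered in turn. *)
Lemma similar_type_ii (X Y : 'M[dual K]_2) : type_ii X -> type_ii Y ->
  similar_mx X Y -> X = Y.
Proof.
move=> /type_iiE[a [b3 [b4 ->]]] /type_iiE[c [d3 [d4 ->]]] s.
move: (similar_mxtrace s) (similar_det s).
rewrite !mkdualmx2_tr !mkdualmx2_det.
rewrite !(mul0r, mulr0, mul1r, addr0, subr0, add0r).
move=> /mkdual_inj[t0 <-] /mkdual_inj[p0].
have -> : c = a by case: (vieta2_uniq t0 p0) => -[].
by move=> /addrI/oppr_inj <-.
Qed.

(** Modulo zeta, type (ii) has a double eigenvalue, whereas type (i) has two distinct ones. *)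
Lemma similar_type_i_ii (X Y : 'M[dual K]_2) : type_i X -> type_ii Y ->
  ~ similar_mx X Y.
Proof.
move=> /type_iE[a1 [a2 [b1 [b2 [ne ->]]]]] /type_iiE[c [d3 [d4 ->]]] s.
move: (similar_mxtrace s) (similar_det s); rewrite !diag2E.
rewrite !mkdualmx2_tr !mkdualmx2_det !(mulr0, subr0).
move=> /mkdual_inj[t0 _] /mkdual_inj[p0 _]; case/eqP: ne.
by case: (vieta2_uniq t0 p0) => -[-> ->].
Qed.

(** Reduction modulo zeta makes two scalar matrices similar, hence equal; [similar_scalar_zeta]
    handles the rest. *)
Lemma similar_mkdual_scalar (a c : K) (B B' : 'M[K]_2) :
  similar_mx (mkdualmx a%:M B) (mkdualmx c%:M B') -> c = a /\ similar_mx B B'.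
Proof.
move=> s; have ca : c = a.
  move: (map_similar_mx dual_re s); rewrite !map_mkdualmx.
  by move/similar_scalar_mx; rewrite !scalar_mx2 => /mx2_inj[].
by split=> //; apply/(similar_scalar_zeta a); rewrite -{2}ca.
Qed.

Lemma not_similar_cyclic_scalar (B : 'M[K]_2) a (Y : 'M[dual K]_2) :
  cyclic_mx (map_mx dual_re Y) -> ~ similar_mx (mkdualmx a%:M B) Y.
Proof.
move=> cY /(map_similar_mx dual_re); rewrite map_mkdualmx.
by move/similar_scalar_mx => e; move: cY; rewrite e => /not_cyclic_scalar.
Qed.

End DualNumbers.

Lemma similar_type_iii_diag (K : fieldType) (X Y : 'M[dual K]_2) :
  type_iii_diag X -> type_iii_diag Y -> similar_mx X Y ->
  X = Y \/ diag_perm X Y.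
Proof.
move=> /type_iii_diagE[a [g1 [g2 ->]]] /type_iii_diagE[c [h1 [h2 ->]]] s.
have [e {}s] := similar_mkdual_scalar s; subst c.
move: (similar_mxtrace s) (similar_det s); rewrite !diag2E.
rewrite !mxtrace_mx2 !det_mx2 !(mulr0, subr0) => t d.
case: (vieta2_uniq t d) => -[-> ->]; [by left|right].
by rewrite scalar_mx2 -!diag2E; apply: mkdualmx_diag_swap.
Qed.

Lemma similar_type_iii_jordan (K : fieldType) (X Y : 'M[dual K]_2) :
  type_iii_jordan X -> type_iii_jordan Y -> similar_mx X Y -> X = Y.
Proof.
move=> /type_iii_jordanE[a [g ->]] /type_iii_jordanE[c [h ->]] s.
have [e {}s] := similar_mkdual_scalar s; subst c.
move: (similar_mxtrace s) (similar_det s); rewrite !jordan_block2E.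
rewrite !mxtrace_mx2 !det_mx2 !(mulr0, subr0) => t d.
by case: (vieta2_uniq t d) => -[->].
Qed.

Lemma similar_type_iii_diag_jordan (K : fieldType) (X Y : 'M[dual K]_2) :
  type_iii_diag X -> type_iii_jordan Y -> ~ similar_mx X Y.
Proof.
move=> /type_iii_diagE[a [g1 [g2 ->]]] /type_iii_jordanE[c [h ->]] s.
have [e {}s] := similar_mkdual_scalar s; subst c.
move: s (similar_mxtrace s) (similar_det s); rewrite diag2E jordan_block2E.
rewrite !mxtrace_mx2 !det_mx2 !(mulr0, subr0) => {}s t d.
have [e1 e2] : g1 = h /\ g2 = h by case: (vieta2_uniq t d).
(* Trace and determinant do not exclude g1 = g2 = h. In that case the diagonal matrix is scalar,
   thus similar only to itself, while the Jordan block has an off-diagonal 1. *)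
subst g1 g2; move: s; rewrite -scalar_mx2 => /similar_scalar_mx.
rewrite scalar_mx2 => /mx2_inj[_ e _ _].
by have := oner_neq0 K; rewrite e eqxx.
Qed.

(** The property that separates types (i) and (ii) from type (iii), whose residue is scalar. *)
Definition residue_cyclic (K : fieldType) (X : 'M[dual K]_2) :=
  cyclic_mx (map_mx (@dual_re K) X).

Lemma type_i_cyclic (K : fieldType) (X : 'M[dual K]_2) :
  type_i X -> residue_cyclic X.
Proof.
move=> /type_iE[a1 [a2 [b1 [b2 [ne ->]]]]].
rewrite /residue_cyclic map_mkdualmx.
by rewrite diag2E; apply: cyclic_nonscalar; rewrite ne !orbT.
Qed.

Lemma type_ii_cyclic (K : fieldType) (X : 'M[dual K]_2) :
  type_ii X -> residue_cyclic X.
Proof.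
move=> /type_iiE[a [b3 [b4 ->]]]; rewrite /residue_cyclic map_mkdualmx.
by apply: cyclic_nonscalar; rewrite oner_neq0.
Qed.

(** * Existence of a representative, and the classification *)

Lemma exists_in_list (K : closedFieldType) (X : 'M[dual K]_2) :
  exists Y, in_list Y /\ similar_mx X Y.
Proof.
have [cX|[a eX]] := cyclic_or_scalar (map_mx (@dual_re K) X); last first.
  (* Scalar residue: the coefficient matrix of zeta is replaced by its Jordan form. *)
  rewrite [X]mkdualmx_surj eX.
  have [J s h] := jordan_form2 (map_mx (@dual_eps K) X).
  exists (mkdualmx a%:M J); split; last exact/similar_scalar_zeta.
  case: h => [[g1 [g2 ->]]|[g ->]].
    by constructor 3; apply/type_iii_diagE; exists a, g1, g2.
  by constructor 4; apply/type_iii_jordanE; exists a, g.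
have [a1 [a2 [s p]]] := vieta2 (dual_re (\tr X)) (dual_re (\det X)).
have [e|ne] := eqVneq a1 a2.
  set b3 := dual_eps (\tr X).
  (* The entry b4 solves a1 b3 - b4 = [dual_eps (\det X)], the zeta coefficient of the determinant
     in type (ii). *)
  pose Y := mkdualmx (mx2 a1 1 0 a1) (mx2 b3 0 (a1 * b3 - dual_eps (\det X)) 0).
  have iiY : type_ii Y by apply/type_iiE; do 3!eexists; reflexivity.
  exists Y; split; first by constructor 2.
  apply: cyclic_similar;
    [exact: cyclic_lift|exact/cyclic_lift/type_ii_cyclic|..].
    by rewrite mkdualmx2_tr [LHS]dualE -s e addr0.
  by rewrite mkdualmx2_det [LHS]dualE -p e; congr mkdual; ring.
(* These solve b1 + b2 = [dual_eps (\tr X)] and a1 b2 + a2 b1 = [dual_eps (\det X)], a linear system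
   that is invertible as a1 and a2 differ. *)
pose b1 := (a1 * dual_eps (\tr X) - dual_eps (\det X)) / (a1 - a2).
pose b2 := dual_eps (\tr X) - b1.
pose Y := mkdualmx (diag2 a1 a2) (diag2 b1 b2).
have iY : type_i Y by apply/type_iE; exists a1, a2, b1, b2.
exists Y; split; first by constructor 1.
apply: cyclic_similar; [exact: cyclic_lift|exact/cyclic_lift/type_i_cyclic|..].
  by rewrite /Y !diag2E mkdualmx2_tr [LHS]dualE -s /b2; congr mkdual; ring.
rewrite /Y !diag2E mkdualmx2_det [LHS]dualE -p /b2 /b1.
by congr mkdual; field; rewrite ?subr_eq0.
Qed.

Lemma not_similar_residue (K : fieldType) (X Y : 'M[dual K]_2) :
  residue_cyclic X -> type_iii_diag Y \/ type_iii_jordan Y -> ~ similar_mx X Y.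
Proof.
move=> cX [/type_iii_diagE[a [g1 [g2 ->]]]|/type_iii_jordanE[a [g ->]]];
  by move/similar_mx_sym; exact: not_similar_cyclic_scalar cX.
Qed.

Theorem mainTheorem6 (K : closedFieldType) (charK0 : [pchar K] =i pred0) :
  (forall X : 'M[dual K]_2,
     exists Y : 'M[dual K]_2, in_list Y /\ similar_mx X Y) /\
  (forall X Y : 'M[dual K]_2, in_list X -> in_list Y ->
     (similar_mx X Y <->
      X = Y \/ [/\ in_list_diag X, in_list_diag Y & diag_perm X Y])).
Proof.
split=> [X|X Y LX LY]; first exact: exists_in_list.
split=> [s|[<-|[_ _]]]; [|exact: similar_mx_refl|exact: similar_diag_perm].
have s' := similar_mx_sym s.
(* Of the sixteen pairs of types, those with two different types are contradictory; the four others
   yield equality or, for diagonal types, possibly a permutation. *)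
case: LX => hX; case: LY => hY.
- case: (similar_type_i hX hY s) => h; first by left.
  by right; split=> //; left.
- by case: (similar_type_i_ii hX hY).
- by case: (not_similar_residue (type_i_cyclic hX) (or_introl hY)).
- by case: (not_similar_residue (type_i_cyclic hX) (or_intror hY)).
- by case: (similar_type_i_ii hY hX).
- by left; apply: similar_type_ii.
- by case: (not_similar_residue (type_ii_cyclic hX) (or_introl hY)).
- by case: (not_similar_residue (type_ii_cyclic hX) (or_intror hY)).
- by case: (not_similar_residue (type_i_cyclic hY) (or_introl hX)).
- by case: (not_similar_residue (type_ii_cyclic hY) (or_introl hX)).
- case: (similar_type_iii_diag hX hY s) => h; first by left.
  by right; split=> //; right.
- by case: (similar_type_iii_diag_jordan hX hY).
- by case: (not_similar_residue (type_i_cyclic hY) (or_intror hX)).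
- by case: (not_similar_residue (type_ii_cyclic hY) (or_intror hX)).
- by case: (similar_type_iii_diag_jordan hY hX).
- by left; apply: similar_type_iii_jordan.
Qed.
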